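(* Let $\mathcal{B}_i$, $i=1,\ldots,k$, be pairwise disjoint closed sub-arrangements of a set-arrangement $\mathcal{A}$ on $X$ such that $\bigcup_{i=1}^k\mathcal{B}_i=\mathcal{A}$. The following are equivalent for a Lie algebra $\mathcal{L}$ of $\mathcal{A}$: 1) $[x,\operatorname{im}(s_{\mathcal{B}_i}')]=0$ for all $i=1,\ldots,k$ and all $x\in X\setminus\operatorname{supp}(\mathcal{B}_i)$; 2) $\operatorname{im}(s_{\mathcal{B}_i}')$ is an ideal in $\mathcal{L}$ for all $i=1,\ldots,k$; 3) $\mathcal{L}'=\sum_{i=1}^k\operatorname{im}(s_{\mathcal{B}_i}')$; 4) $s'$ is surjective; 5) $\pi'$ is injective. If these conditions are satisfied, then $$\mathcal{L}'=\bigoplus_{i=1}^k\operatorname{im}(s_{\mathcal{B}_i}')\cong\bigoplus_{i=1}^k\mathcal{L}_{\mathcal{B}_i}'$$ as Lie algebras.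
   Context: Let $C$ be a commutative ring with unit. All Lie algebras are ordinary (non-super) Lie algebras over $C$; $\mathcal{F}(Y)$ denotes the free Lie algebra over $C$ on a set $Y$, and $\mathfrak{g}'=[\mathfrak{g},\mathfrak{g}]$ the derived Lie algebra. Direct sums of Lie algebras carry the componentwise bracket. A set-arrangement on a finite set $X=\{x_1,\ldots,x_n\}$, $n\ge 2$, is a set $\mathcal{A}$ of subsets of $X$ such that each set in $\mathcal{A}$ has at least two elements, two different sets in $\mathcal{A}$ have at most one element in common, and the union of all the sets in $\mathcal{A}$ is $X$. A Lie algebra $\mathcal{L}$ of the set-arrangement $\mathcal{A}$ is a quotient of $\mathcal{F}(X)$ by the ideal generated by all $[x_i,x_j]$ such that $\{x_i,x_j\}$ is not a subset of any $A\in\mathcal{A}$, together with $R=\bigcup_{A\in\mathcal{A}}R_A$, where for each $A\in\mathcal{A}$, $R_A$ is a given subset of $\mathcal{F}(A)'$. For $\mathcal{B}\subseteq\mathcal{A}$, $\operatorname{supp}(\mathcal{B})=\bigcup_{B\in\mathcal{B}}B$; $\mathcal{B}$ is a closed sub-arrangement of $\mathcal{A}$ if $|A\cap\operatorname{supp}(\mathcal{B})|\le 1$ for all $A\in\mathcal{A}\setminus\mathcal{B}$. For a closed sub-arrangement $\mathcal{B}$, the localized Lie algebra at $\mathcal{B}$ is $\mathcal{L}_{\mathcal{B}}=\mathcal{F}(\operatorname{supp}(\mathcal{B}))/\langle R_{\mathcal{B}}\rangle$, where $$R_{\mathcal{B}}=\bigcup_{B\in\mathcal{B}}R_B\cup\{[x,y]:\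 x,y\in\operatorname{supp}(\mathcal{B})\text{ and } \{x,y\}\not\subseteq B \text{ for all } B\in\mathcal{B}\}.$$ $s_{\mathcal{B}}:\mathcal{L}_{\mathcal{B}}\to\mathcal{L}$ is the natural (well-defined) Lie algebra morphism sending each generator to itself, and $\pi_{\mathcal{B}}:\mathcal{L}\to\mathcal{L}_{\mathcal{B}}$ is the (well-defined) Lie algebra morphism sending all generators not in $\operatorname{supp}(\mathcal{B})$ to zero and each generator in $\operatorname{supp}(\mathcal{B})$ to itself. $s_{\mathcal{B}}':\mathcal{L}_{\mathcal{B}}'\to\mathcal{L}'$ and $\pi_{\mathcal{B}}':\mathcal{L}'\to\mathcal{L}_{\mathcal{B}}'$ are their restrictions to derived algebras. Given $\mathcal{B}_1,\ldots,\mathcal{B}_k$ as in the claim (a partition of $\mathcal{A}$, not of $\operatorname{supp}(\mathcal{A})$), the $C$-module morphisms $s'$ and $\pi'$ are $$s'=\sum_{i=1}^k s_{\mathcal{B}_i}':\ \bigoplus_{i=1}^k\mathcal{L}_{\mathcal{B}_i}'\to\mathcal{L}',\qquad \pi'=\bigoplus_{i=1}^k\pi_{\mathcal{B}_i}':\ \mathcal{L}'\to\bigoplus_{i=1}^k\mathcal{L}_{\mathcal{B}_i}'.$$ *)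

(* Defs.v *)
From HB Require Import structures.
From mathcomp Require Import all_boot all_order all_algebra.
From mathcomp Require Import boolp classical_sets.

Set Implicit Arguments.
Unset Strict Implicit.
Unset Printing Implicit Defensive.

Import GRing.Theory.

Local Open Scope ring_scope.
Local Open Scope classical_set_scope.
Local Open Scope quotient_scope.

Identity Coercion fun_of_set : set >-> Funclass.

HB.mixin Record isLieAlgebra (C : comPzRingType) L of GRing.Lmodule C L := {
  lie : L -> L -> L;
  lie_linearl : forall (a : C) x y z,
    lie (a *: x + y) z = a *: lie x z + lie y z;
  lie_linearr : forall (a : C) x y z,
    lie z (a *: x + y) = a *: lie z x + lie z y;
  liexx : forall x, lie x x = 0;
  lie_jacobi : forall x y z,
    lie x (lie y z) + (lie y (lie z x) + lie z (lie x y)) = 0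
}.

#[short(type="lieAlgType")]
HB.structure Definition LieAlgebra (C : comPzRingType) :=
  {L of isLieAlgebra C L & GRing.Lmodule C L}.

Arguments lie {C s} : rename, simpl never.

HB.mixin Record isLieMorphism (C : comPzRingType) (L M : lieAlgType C)
    (f : L -> M) := {
  lie_morph : {morph f : x y / lie x y >-> lie x y}
}.

HB.structure Definition LieMorphism (C : comPzRingType) (L M : lieAlgType C) :=
  {f of isLieMorphism C L M f & @GRing.Linear C L M *:%R f}.

Notation "{ 'lie' L -> M }" := (LieMorphism.type L M)
  (at level 0, L at level 98, M at level 99,
   format "{ 'lie'  L  ->  M }") : type_scope.

Section Composition.
Variables (C : comPzRingType) (L M N : lieAlgType C).
Variables (g : {lie M -> N}) (f : {lie L -> M}).

Fact comp_lie_morph : {morph g \o f : x y / lie x y >-> lie x y}.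
Proof. by move=> x y; rewrite /= !lie_morph. Qed.

HB.instance Definition _ := isLieMorphism.Build C L N (g \o f) comp_lie_morph.

End Composition.

Definition lie_isomorphic (C : comPzRingType) (L M : lieAlgType C) : Prop :=
  exists f : {lie L -> M}, bijective f.

Section LieBasics.
Variables (C : comPzRingType) (L : lieAlgType C).
Implicit Types x y z : L.

Lemma lieDl x y z : lie (x + y) z = lie x z + lie y z.
Proof. by rewrite -[x in LHS]scale1r lie_linearl scale1r. Qed.
Lemma lieDr x y z : lie z (x + y) = lie z x + lie z y.
Proof. by rewrite -[x in LHS]scale1r lie_linearr scale1r. Qed.
Lemma lie0x z : lie 0 z = 0.
Proof. by apply: (addrI (lie 0 z)); rewrite -lieDl !addr0. Qed.
Lemma liex0 z : lie z 0 = 0.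
Proof. by apply: (addrI (lie z 0)); rewrite -lieDr !addr0. Qed.
Lemma lieZl (a : C) x z : lie (a *: x) z = a *: lie x z.
Proof. by rewrite -[a *: x]addr0 lie_linearl lie0x addr0. Qed.
Lemma lieZr (a : C) x z : lie z (a *: x) = a *: lie z x.
Proof. by rewrite -[a *: x]addr0 lie_linearr liex0 addr0. Qed.
Lemma lieNx x z : lie (- x) z = - lie x z.
Proof. by rewrite -scaleN1r lieZl scaleN1r. Qed.
Lemma liexN x z : lie z (- x) = - lie z x.
Proof. by rewrite -scaleN1r lieZr scaleN1r. Qed.
Lemma lieC x y : lie x y = - lie y x.
Proof.
have := liexx (x + y); rewrite lieDl !lieDr !liexx add0r addr0 => /eqP.
by rewrite addr_eq0 => /eqP.
Qed.

End LieBasics.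

Section Substructures.
Variables (C : comPzRingType) (L : lieAlgType C).
Implicit Types S U : set L.

Definition is_submodule U : Prop :=
  U 0 /\ forall (a : C) x y, U x -> U y -> U (a *: x + y).

Definition is_lie_ideal U : Prop :=
  is_submodule U /\ forall x y, U y -> U (lie x y).

Definition is_lie_subalgebra U : Prop :=
  is_submodule U /\ forall x y, U x -> U y -> U (lie x y).

Definition submodule_span S : set L :=
  [set x | forall U, is_submodule U -> S `<=` U -> U x].

Definition ideal_span S : set L :=
  [set x | forall U, is_lie_ideal U -> S `<=` U -> U x].

Record lieIdeal := LieIdeal {
  ideal_set :> set L;
  ideal_setP : is_lie_ideal ideal_set
}.

Record lieSubalgebra := LieSubalgebra {
  subalgebra_set :> set L;
  subalgebra_setP : is_lie_subalgebra subalgebra_set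
}.

Lemma submoduleD U x y : is_submodule U -> U x -> U y -> U (x + y).
Proof. by case=> _ UD Ux Uy; rewrite -[x]scale1r; apply: UD. Qed.
Lemma submoduleZ U (a : C) x : is_submodule U -> U x -> U (a *: x).
Proof. by case=> U0 UD Ux; rewrite -[_ *: _]addr0; apply: UD. Qed.
Lemma submoduleN U x : is_submodule U -> U x -> U (- x).
Proof. by move=> sU Ux; rewrite -scaleN1r; apply: submoduleZ. Qed.

Lemma submodule_spanP S : is_submodule (submodule_span S).
Proof.
split=> [U [] //|a x y Sx Sy U sU SU].
by apply: sU.2; [apply: Sx|apply: Sy].
Qed.

Lemma submodule_span_sub S : S `<=` submodule_span S.
Proof. by move=> x Sx U _; apply. Qed.

Lemma ideal_spanP S : is_lie_ideal (ideal_span S).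
Proof.
split; first split=> [U [[]] //|a x y Sx Sy U iU SU].
  by apply: iU.1.2; [apply: Sx|apply: Sy].
by move=> x y Sy U iU SU; apply: iU.2; apply: Sy.
Qed.

Lemma ideal_span_sub S : S `<=` ideal_span S.
Proof. by move=> x Sx U _; apply. Qed.

Definition ideal_gen S : lieIdeal := LieIdeal (ideal_spanP S).

(* The subalgebra [L, L]: the C-module spanned by all brackets. *)
Definition derived_set : set L :=
  submodule_span [set w | exists x y, w = lie x y].

Lemma derived_setP : is_lie_subalgebra derived_set.
Proof.
split=> [|x y _ _]; first exact: submodule_spanP.
by apply: submodule_span_sub; exists x, y.
Qed.

Definition derived : lieSubalgebra := LieSubalgebra derived_setP.

End Substructures.

Arguments derived {C} L.

Section SubalgebraType.
Variables (C : comPzRingType) (L : lieAlgType C) (U : lieSubalgebra L).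

Definition subalgebra_pred : {pred L} := fun x => `[< U x >].

Definition subalgebra_type := {x : L | subalgebra_pred x}.

Lemma subalgebra_closed : subsemimod_closed subalgebra_pred.
Proof.
have [sU _] := subalgebra_setP U; split; first split.
- by apply/asboolP; case: sU.
- by move=> x y /asboolP Ux /asboolP Uy; apply/asboolP; apply: submoduleD.
- by move=> a x /asboolP Ux; apply/asboolP; apply: submoduleZ.
Qed.

HB.instance Definition _ := SubChoice.on subalgebra_type.
HB.instance Definition _ := GRing.SubChoice_isSubLmodule.Build
  C L subalgebra_pred subalgebra_type subalgebra_closed.

Implicit Types x y z : subalgebra_type.

Lemma subalgebra_typeP x : U (val x).
Proof. exact/asboolP/(valP x). Qed.

Definition subalgebra_elt (x : L) (Ux : U x) : subalgebra_type :=
  exist _ x (asboolT Ux).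

Definition subalgebra_lie x y : subalgebra_type :=
  subalgebra_elt
    ((subalgebra_setP U).2 _ _ (subalgebra_typeP x) (subalgebra_typeP y)).

Fact subalgebra_lie_linearl (a : C) x y z :
  subalgebra_lie (a *: x + y) z = a *: subalgebra_lie x z + subalgebra_lie y z.
Proof. by apply: val_inj; exact: lie_linearl. Qed.
Fact subalgebra_lie_linearr (a : C) x y z :
  subalgebra_lie z (a *: x + y) = a *: subalgebra_lie z x + subalgebra_lie z y.
Proof. by apply: val_inj; exact: lie_linearr. Qed.
Fact subalgebra_liexx x : subalgebra_lie x x = 0.
Proof. by apply: val_inj; exact: liexx. Qed.
Fact subalgebra_lie_jacobi x y z :
  subalgebra_lie x (subalgebra_lie y z) +
  (subalgebra_lie y (subalgebra_lie z x) +
   subalgebra_lie z (subalgebra_lie x y)) = 0.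
Proof. by apply: val_inj; exact: lie_jacobi. Qed.

HB.instance Definition _ := isLieAlgebra.Build C subalgebra_type
  subalgebra_lie_linearl subalgebra_lie_linearr
  subalgebra_liexx subalgebra_lie_jacobi.

End SubalgebraType.

Notation derived_alg L := (subalgebra_type (derived L)).

Local Notation dext := functional_extensionality_dep.

Section DirectSum.
Variables (C : comPzRingType) (I : finType) (L : I -> lieAlgType C).

Definition lie_dsum := forall i, L i.

HB.instance Definition _ := Choice.on lie_dsum.

Implicit Types u v w : lie_dsum.

Definition dsum_zero : lie_dsum := fun i => 0.
Definition dsum_opp u : lie_dsum := fun i => - u i.
Definition dsum_add u v : lie_dsum := fun i => u i + v i.
Definition dsum_scale (a : C) u : lie_dsum := fun i => a *: u i.
Definition dsum_lie u v : lie_dsum := fun i => lie (u i) (v i).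

Fact dsum_addA : associative dsum_add.
Proof. by move=> u v w; apply: dext => i; apply: addrA. Qed.
Fact dsum_addC : commutative dsum_add.
Proof. by move=> u v; apply: dext => i; apply: addrC. Qed.
Fact dsum_add0 : left_id dsum_zero dsum_add.
Proof. by move=> u; apply: dext => i; apply: add0r. Qed.
Fact dsum_addN : left_inverse dsum_zero dsum_opp dsum_add.
Proof. by move=> u; apply: dext => i; apply: addNr. Qed.

HB.instance Definition _ := GRing.isZmodule.Build lie_dsum
  dsum_addA dsum_addC dsum_add0 dsum_addN.

Fact dsum_scaleA a b u : dsum_scale a (dsum_scale b u) = dsum_scale (a * b) u.
Proof. by apply: dext => i; apply: scalerA. Qed.
Fact dsum_scale1 : left_id 1 dsum_scale.
Proof. by move=> u; apply: dext => i; apply: scale1r. Qed.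
Fact dsum_scaleDr : right_distributive dsum_scale +%R.
Proof. by move=> a u v; apply: dext => i; apply: scalerDr. Qed.
Fact dsum_scaleDl u : {morph dsum_scale^~ u : a b / a + b}.
Proof. by move=> a b; apply: dext => i; apply: scalerDl. Qed.

HB.instance Definition _ := GRing.Zmodule_isLmodule.Build C lie_dsum
  dsum_scaleA dsum_scale1 dsum_scaleDr dsum_scaleDl.

Fact dsum_lie_linearl (a : C) u v w :
  dsum_lie (a *: u + v) w = a *: dsum_lie u w + dsum_lie v w.
Proof. by apply: dext => i; apply: lie_linearl. Qed.
Fact dsum_lie_linearr (a : C) u v w :
  dsum_lie w (a *: u + v) = a *: dsum_lie w u + dsum_lie w v.
Proof. by apply: dext => i; apply: lie_linearr. Qed.
Fact dsum_liexx u : dsum_lie u u = 0.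
Proof. by apply: dext => i; apply: liexx. Qed.
Fact dsum_lie_jacobi u v w :
  dsum_lie u (dsum_lie v w) +
  (dsum_lie v (dsum_lie w u) + dsum_lie w (dsum_lie u v)) = 0.
Proof. by apply: dext => i; apply: lie_jacobi. Qed.

HB.instance Definition _ := isLieAlgebra.Build C lie_dsum
  dsum_lie_linearl dsum_lie_linearr dsum_liexx dsum_lie_jacobi.

End DirectSum.

Section InternalSums.
Variables (C : comPzRingType) (L : lieAlgType C) (I : finType).
Implicit Type U : I -> lieSubalgebra L.

Definition submodule_sum U : set L :=
  [set x | exists2 u : I -> L, (forall i, U i (u i)) & x = \sum_i u i].

Definition dsum_addition U
    (u : lie_dsum (fun i => subalgebra_type (U i) : lieAlgType C)) : L :=
  \sum_i val (u i).

(* [D] is the direct sum of the subalgebras [U i] as a Lie algebra: addition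
   is an isomorphism of Lie algebras from their external direct sum onto [D]. *)
Definition lie_internal_dsum (D : set L) U : Prop :=
  [/\ range (@dsum_addition U) = D,
      injective (@dsum_addition U) &
      {morph (@dsum_addition U) : u v / lie u v >-> lie u v}].

End InternalSums.

Section DerivedMap.
Variables (C : comPzRingType) (L M : lieAlgType C) (f : {lie L -> M}).

Lemma derived_map_subproof (x : L) : derived L x -> derived M (f x).
Proof.
move=> Lx; have [[M0 MD] Mlie] := derived_setP M.
apply: (Lx [set y | derived M (f y)]) => [|_ [u [v ->]]] /=.
  by split=> [|a u v Mu Mv] /=; rewrite ?raddf0 // linearP; apply: MD.
by rewrite lie_morph; apply: submodule_span_sub; exists (f u), (f v).
Qed.

Definition derived_map (x : derived_alg L) : derived_alg M :=
  subalgebra_elt (derived_map_subproof (subalgebra_typeP x)).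

Fact derived_map_linear : linear derived_map.
Proof. by move=> a x y; apply: val_inj; rewrite linearP /= !linearP. Qed.
Fact derived_map_lie : {morph derived_map : x y / lie x y >-> lie x y}.
Proof. by move=> x y; apply: val_inj; rewrite /= lie_morph. Qed.

HB.instance Definition _ := GRing.isLinear.Build
  C (derived_alg L) (derived_alg M) *:%R derived_map derived_map_linear.
HB.instance Definition _ := isLieMorphism.Build
  C (derived_alg L) (derived_alg M) derived_map derived_map_lie.

Definition derived_image_set : set M := [set val (derived_map u) | u in setT].

Lemma derived_image_setP : is_lie_subalgebra derived_image_set.
Proof.
split; first split.
- by exists 0; rewrite // !raddf0.
- by move=> a _ _ [u _ <-] [v _ <-]; exists (a *: u + v); rewrite // !linearP.
- by move=> _ _ [u _ <-] [v _ <-]; exists (lie u v); rewrite // lie_morph.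
Qed.

(* The image of [derived_map], as a subalgebra of [M]. *)
Definition derived_image : lieSubalgebra M := LieSubalgebra derived_image_setP.

End DerivedMap.

(* The free Lie algebra on [Y]: formal expressions modulo the congruence
   generated by the axioms of Lie algebras over [C]. *)

Inductive lieTerm (C : comPzRingType) (Y : Type) : Type :=
  | TVar of Y
  | TZero
  | TOpp of lieTerm C Y
  | TAdd of lieTerm C Y & lieTerm C Y
  | TScale of C & lieTerm C Y
  | TLie of lieTerm C Y & lieTerm C Y.

Arguments TVar {C Y}.
Arguments TZero {C Y}.

Inductive lieTermEq (C : comPzRingType) (Y : Type) :
    lieTerm C Y -> lieTerm C Y -> Prop :=
  | TEq_refl s : lieTermEq s s
  | TEq_sym s t : lieTermEq s t -> lieTermEq t s
  | TEq_trans s t r : lieTermEq s t -> lieTermEq t r -> lieTermEq s r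
  | TEq_opp s t : lieTermEq s t -> lieTermEq (TOpp s) (TOpp t)
  | TEq_add s s' t t' :
      lieTermEq s s' -> lieTermEq t t' -> lieTermEq (TAdd s t) (TAdd s' t')
  | TEq_scale a s t : lieTermEq s t -> lieTermEq (TScale a s) (TScale a t)
  | TEq_lie s s' t t' :
      lieTermEq s s' -> lieTermEq t t' -> lieTermEq (TLie s t) (TLie s' t')
  | TEq_addA s t r : lieTermEq (TAdd s (TAdd t r)) (TAdd (TAdd s t) r)
  | TEq_addC s t : lieTermEq (TAdd s t) (TAdd t s)
  | TEq_add0 s : lieTermEq (TAdd TZero s) s
  | TEq_addN s : lieTermEq (TAdd (TOpp s) s) TZero
  | TEq_scaleA a b s : lieTermEq (TScale a (TScale b s)) (TScale (a * b) s)
  | TEq_scale1 s : lieTermEq (TScale 1 s) s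
  | TEq_scaleDr a s t :
      lieTermEq (TScale a (TAdd s t)) (TAdd (TScale a s) (TScale a t))
  | TEq_scaleDl a b s :
      lieTermEq (TScale (a + b) s) (TAdd (TScale a s) (TScale b s))
  | TEq_liel a s t r :
      lieTermEq (TLie (TAdd (TScale a s) t) r)
                (TAdd (TScale a (TLie s r)) (TLie t r))
  | TEq_lier a s t r :
      lieTermEq (TLie r (TAdd (TScale a s) t))
                (TAdd (TScale a (TLie r s)) (TLie r t))
  | TEq_liexx s : lieTermEq (TLie s s) TZero
  | TEq_jacobi s t r :
      lieTermEq (TAdd (TLie s (TLie t r))
                      (TAdd (TLie t (TLie r s)) (TLie r (TLie s t)))) TZero.

HB.instance Definition _ (C : comPzRingType) (Y : Type) :=
  gen_eqMixin (lieTerm C Y).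
HB.instance Definition _ (C : comPzRingType) (Y : Type) :=
  gen_choiceMixin (lieTerm C Y).

Section FreeLie.
Variables (C : comPzRingType) (Y : Type).
Implicit Types s t r : lieTerm C Y.

Definition lieTerm_rel s t : bool := `[< lieTermEq s t >].

Fact lieTerm_rel_refl : reflexive lieTerm_rel.
Proof. by move=> s; apply/asboolP/TEq_refl. Qed.
Fact lieTerm_rel_sym : symmetric lieTerm_rel.
Proof. by move=> s t; apply: asbool_equiv_eq; split; apply: TEq_sym. Qed.
Fact lieTerm_rel_trans : transitive lieTerm_rel.
Proof.
by move=> t s r /asboolP st /asboolP tr; apply/asboolP/(TEq_trans st tr).
Qed.

Canonical lieTerm_equiv :=
  EquivRel lieTerm_rel lieTerm_rel_refl lieTerm_rel_sym lieTerm_rel_trans.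

Definition freeLie : Type := {eq_quot lieTerm_equiv}.
HB.instance Definition _ := Choice.on freeLie.

Definition free_class t : freeLie := \pi_{eq_quot lieTerm_equiv} t.
Definition free_repr (x : freeLie) : lieTerm C Y :=
  repr (x : {eq_quot lieTerm_equiv}).

Lemma free_classP s t : free_class s = free_class t <-> lieTermEq s t.
Proof.
split; last by move=> st; apply/eqquotP/asboolP.
by move=> /eqquotP/asboolP.
Qed.

Lemma free_reprK : cancel free_repr free_class.
Proof. exact: reprK. Qed.

Lemma free_repr_class t : lieTermEq (free_repr (free_class t)) t.
Proof. by apply/free_classP; rewrite free_reprK. Qed.

Implicit Types x y z : freeLie.

Definition free_zero : freeLie := free_class TZero.
Definition free_opp x := free_class (TOpp (free_repr x)).
Definition free_add x y := free_class (TAdd (free_repr x) (free_repr y)).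
Definition free_scale (a : C) x := free_class (TScale a (free_repr x)).
Definition free_lie x y := free_class (TLie (free_repr x) (free_repr y)).

Lemma free_oppE t : free_opp (free_class t) = free_class (TOpp t).
Proof. by apply/free_classP/TEq_opp/free_repr_class. Qed.
Lemma free_addE s t :
  free_add (free_class s) (free_class t) = free_class (TAdd s t).
Proof. by apply/free_classP/TEq_add; apply: free_repr_class. Qed.
Lemma free_scaleE a t : free_scale a (free_class t) = free_class (TScale a t).
Proof. by apply/free_classP/TEq_scale/free_repr_class. Qed.
Lemma free_lieE s t :
  free_lie (free_class s) (free_class t) = free_class (TLie s t).
Proof. by apply/free_classP/TEq_lie; apply: free_repr_class. Qed.

Let freeE := (free_oppE, free_addE, free_scaleE, free_lieE).

Lemma free_ind (P : freeLie -> Prop) :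
  (forall t, P (free_class t)) -> forall x, P x.
Proof. by move=> Pc x; rewrite -[x]free_reprK. Qed.

Fact free_addA : associative free_add.
Proof.
elim/free_ind=> s; elim/free_ind=> t; elim/free_ind=> r.
by rewrite !freeE; apply/free_classP/TEq_addA.
Qed.
Fact free_addC : commutative free_add.
Proof.
elim/free_ind=> s; elim/free_ind=> t.
by rewrite !freeE; apply/free_classP/TEq_addC.
Qed.
Fact free_add0 : left_id free_zero free_add.
Proof. by elim/free_ind=> s; rewrite !freeE; apply/free_classP/TEq_add0. Qed.
Fact free_addN : left_inverse free_zero free_opp free_add.
Proof. by elim/free_ind=> s; rewrite !freeE; apply/free_classP/TEq_addN. Qed.

HB.instance Definition _ := GRing.isZmodule.Build freeLie
  free_addA free_addC free_add0 free_addN.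

Fact free_scaleA a b x : free_scale a (free_scale b x) = free_scale (a * b) x.
Proof.
by elim/free_ind: x => s; rewrite !freeE; apply/free_classP/TEq_scaleA.
Qed.
Fact free_scale1 : left_id 1 free_scale.
Proof. by elim/free_ind=> s; rewrite !freeE; apply/free_classP/TEq_scale1. Qed.
Fact free_scaleDr : right_distributive free_scale +%R.
Proof.
move=> a; elim/free_ind=> s; elim/free_ind=> t; rewrite /GRing.add /=.
by rewrite !freeE; apply/free_classP/TEq_scaleDr.
Qed.
Fact free_scaleDl x : {morph free_scale^~ x : a b / a + b}.
Proof.
elim/free_ind: x => s a b; rewrite [RHS]/GRing.add /=.
by rewrite !freeE; apply/free_classP/TEq_scaleDl.
Qed.

HB.instance Definition _ := GRing.Zmodule_isLmodule.Build C freeLie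
  free_scaleA free_scale1 free_scaleDr free_scaleDl.

Fact free_lie_linearl (a : C) x y z :
  free_lie (a *: x + y) z = a *: free_lie x z + free_lie y z.
Proof.
elim/free_ind: x => s; elim/free_ind: y => t; elim/free_ind: z => r.
rewrite /GRing.add /GRing.scale /= !freeE; exact/free_classP/TEq_liel.
Qed.
Fact free_lie_linearr (a : C) x y z :
  free_lie z (a *: x + y) = a *: free_lie z x + free_lie z y.
Proof.
elim/free_ind: x => s; elim/free_ind: y => t; elim/free_ind: z => r.
rewrite /GRing.add /GRing.scale /= !freeE; exact/free_classP/TEq_lier.
Qed.
Fact free_liexx x : free_lie x x = 0.
Proof.
by elim/free_ind: x => s; rewrite !freeE; apply/free_classP/TEq_liexx.
Qed.
Fact free_lie_jacobi x y z :
  free_lie x (free_lie y z) +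
  (free_lie y (free_lie z x) + free_lie z (free_lie x y)) = 0.
Proof.
elim/free_ind: x => s; elim/free_ind: y => t; elim/free_ind: z => r.
rewrite /GRing.add /= !freeE; exact/free_classP/TEq_jacobi.
Qed.

HB.instance Definition _ := isLieAlgebra.Build C freeLie
  free_lie_linearl free_lie_linearr free_liexx free_lie_jacobi.

Definition free_gen (y : Y) : freeLie := free_class (TVar y).

Section Lift.
Variables (L : lieAlgType C) (f : Y -> L).

Fixpoint lieTerm_eval t : L :=
  match t with
  | TVar y => f y
  | TZero => 0
  | TOpp t => - lieTerm_eval t
  | TAdd s t => lieTerm_eval s + lieTerm_eval t
  | TScale a t => a *: lieTerm_eval t
  | TLie s t => lie (lieTerm_eval s) (lieTerm_eval t)
  end.

Lemma lieTerm_evalP s t : lieTermEq s t -> lieTerm_eval s = lieTerm_eval t.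
Proof.
elim=> //= {s t}; try by move=> *; congruence.
- by move=> *; exact: addrA.
- by move=> *; exact: addrC.
- by move=> *; exact: add0r.
- by move=> *; exact: addNr.
- by move=> *; exact: scalerA.
- by move=> *; exact: scale1r.
- by move=> *; exact: scalerDr.
- by move=> *; exact: scalerDl.
- by move=> *; exact: lie_linearl.
- by move=> *; exact: lie_linearr.
- by move=> *; exact: liexx.
- by move=> *; exact: lie_jacobi.
Qed.

Definition free_lift (x : freeLie) : L := lieTerm_eval (free_repr x).

Lemma free_lift_class t : free_lift (free_class t) = lieTerm_eval t.
Proof. exact/lieTerm_evalP/free_repr_class. Qed.

Fact free_lift_linear : linear free_lift.
Proof.
move=> a; elim/free_ind=> s; elim/free_ind=> t.
rewrite [X in free_lift (X + _)]/GRing.scale /= [X in free_lift X]/GRing.add /=.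
by rewrite !freeE !free_lift_class.
Qed.
Fact free_lift_lie : {morph free_lift : x y / lie x y >-> lie x y}.
Proof.
elim/free_ind=> s; elim/free_ind=> t.
by rewrite [X in free_lift X]/lie /= freeE !free_lift_class.
Qed.

HB.instance Definition _ :=
  GRing.isLinear.Build C freeLie L *:%R free_lift free_lift_linear.
HB.instance Definition _ :=
  isLieMorphism.Build C freeLie L free_lift free_lift_lie.

Lemma free_liftE (y : Y) : free_lift (free_gen y) = f y.
Proof. exact: free_lift_class. Qed.

Lemma free_lift_unique (g : {lie freeLie -> L}) :
  (forall y : Y, g (free_gen y) = f y) -> g =1 free_lift.
Proof.
move=> gf; elim/free_ind; elim=> [y||t IH|s IHs t IHt|a t IH|s IHs t IHt].
- by rewrite free_liftE gf.
- by rewrite -[free_class _]/(0 : freeLie) !raddf0.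
- by rewrite -free_oppE -[free_opp _]/(- free_class t) !raddfN /= IH.
- rewrite -free_addE -[free_add _ _]/(free_class s + free_class t).
  by rewrite !raddfD /= IHs IHt.
- rewrite -free_scaleE -[free_scale _ _]/(a *: free_class t).
  by rewrite !linearZ_LR /= IH.
- rewrite -free_lieE -[free_lie _ _]/(lie (free_class s) (free_class t)).
  by rewrite !lie_morph IHs IHt.
Qed.

End Lift.
End FreeLie.

Definition free_map (C : comPzRingType) (Y Z : Type) (h : Y -> Z) :
    {lie freeLie C Y -> freeLie C Z} :=
  free_lift (fun y => free_gen C (h y)).

Lemma free_mapE (C : comPzRingType) (Y Z : Type) (h : Y -> Z) (y : Y) :
  free_map C h (free_gen C y) = free_gen C (h y).
Proof. exact: free_liftE. Qed.

Section FreeMap.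
Variables (C : comPzRingType) (Y Z : Type) (L M : lieAlgType C).

Lemma free_lift_comp (g : {lie L -> M}) (f : Y -> L) (x : freeLie C Y) :
  g (free_lift f x) = free_lift (g \o f) x.
Proof.
rewrite -[LHS]/((g \o free_lift f) x).
by apply: free_lift_unique => y /=; rewrite free_liftE.
Qed.

Lemma free_lift_map (f : Z -> L) (h : Y -> Z) (x : freeLie C Y) :
  free_lift f (free_map C h x) = free_lift (f \o h) x.
Proof.
rewrite -[LHS]/((free_lift f \o free_map C h) x).
apply: free_lift_unique => y.
rewrite -[LHS]/(free_lift f (free_map C h (free_gen C y))).
by rewrite free_mapE free_liftE.
Qed.

Lemma eq_free_lift (f g : Y -> L) : f =1 g -> free_lift f =1 free_lift g.
Proof. by move=> fg; apply: free_lift_unique => y /=; rewrite free_liftE. Qed.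

(* A morphism sending all generators to multiples of one vector kills the
   derived algebra. *)
Lemma free_lift_line (f : Y -> L) (v : L) (x : freeLie C Y) :
  (forall y, exists c, f y = c *: v) -> exists c, free_lift f x = c *: v.
Proof.
move=> fv; elim/free_ind: x => t; rewrite free_lift_class.
elim: t => [y||t [c IH]|s [c IHs] t [d IHt]|a t [c IH]|s [c IHs] t [d IHt]] /=.
- exact: fv.
- by exists 0; rewrite scale0r.
- by exists (- c); rewrite IH scaleNr.
- by exists (c + d); rewrite IHs IHt scalerDl.
- by exists (a * c); rewrite IH scalerA.
- by exists 0; rewrite IHs IHt lieZl lieZr liexx !scaler0 scale0r.
Qed.

Lemma free_lift_line_derived (f : Y -> L) (v : L) (x : freeLie C Y) :
  (forall y, exists c, f y = c *: v) -> derived (freeLie C Y) x ->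
  free_lift f x = 0.
Proof.
move=> fv Dx; apply: (Dx [set y | free_lift f y = 0]) => [|_ [s [t ->]]] /=.
  split=> [|a s t /= fs ft]; first by rewrite /= raddf0.
  by rewrite linearP /= fs ft scaler0 addr0.
have [c Ec] := free_lift_line s fv; have [d Ed] := free_lift_line t fv.
by rewrite lie_morph /= Ec Ed lieZl lieZr liexx !scaler0.
Qed.

End FreeMap.

Section Quotient.
Variables (C : comPzRingType) (L : lieAlgType C) (I : lieIdeal L).
Implicit Types x y z : L.

Definition ideal_rel x y : bool := `[< I (x - y) >].

Fact ideal_rel_refl : reflexive ideal_rel.
Proof.
by move=> x; apply/asboolP; rewrite subrr; case: (ideal_setP I) => -[].
Qed.
Fact ideal_rel_sym : symmetric ideal_rel.
Proof.
have [sI _] := ideal_setP I.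
by move=> x y; apply: asbool_equiv_eq; split=> Ixy;
  rewrite -opprB; apply: submoduleN.
Qed.
Fact ideal_rel_trans : transitive ideal_rel.
Proof.
have [sI _] := ideal_setP I.
move=> y x z /asboolP xy /asboolP yz; apply/asboolP.
by rewrite -(subrK y x) -addrA; apply: submoduleD.
Qed.

Canonical ideal_equiv :=
  EquivRel ideal_rel ideal_rel_refl ideal_rel_sym ideal_rel_trans.

Definition lie_quotient : Type := {eq_quot ideal_equiv}.
HB.instance Definition _ := Choice.on lie_quotient.

Definition quo_pi x : lie_quotient := \pi_{eq_quot ideal_equiv} x.
Definition quo_repr (q : lie_quotient) : L := repr (q : {eq_quot ideal_equiv}).

Lemma quo_piP x y : quo_pi x = quo_pi y <-> I (x - y).
Proof.
split; last by move=> xy; apply/eqquotP/asboolP.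
by move=> /eqquotP/asboolP.
Qed.

Lemma quo_reprK : cancel quo_repr quo_pi.
Proof. exact: reprK. Qed.

Lemma quo_repr_pi x : I (quo_repr (quo_pi x) - x).
Proof. by apply/quo_piP; rewrite quo_reprK. Qed.

Lemma quo_ind (P : lie_quotient -> Prop) :
  (forall x, P (quo_pi x)) -> forall q, P q.
Proof. by move=> Pc q; rewrite -[q]quo_reprK. Qed.

Implicit Types p q r : lie_quotient.

Definition quo_opp q := quo_pi (- quo_repr q).
Definition quo_add p q := quo_pi (quo_repr p + quo_repr q).
Definition quo_scale (a : C) q := quo_pi (a *: quo_repr q).
Definition quo_lie p q := quo_pi (lie (quo_repr p) (quo_repr q)).

Lemma quo_oppE x : quo_opp (quo_pi x) = quo_pi (- x).
Proof.
have [sI _] := ideal_setP I; apply/quo_piP; rewrite -opprD.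
by apply: submoduleN => //; exact: quo_repr_pi.
Qed.
Lemma quo_addE x y : quo_add (quo_pi x) (quo_pi y) = quo_pi (x + y).
Proof.
have [sI _] := ideal_setP I; apply/quo_piP; rewrite opprD addrACA.
by apply: submoduleD => //; exact: quo_repr_pi.
Qed.
Lemma quo_scaleE a x : quo_scale a (quo_pi x) = quo_pi (a *: x).
Proof.
have [sI _] := ideal_setP I; apply/quo_piP; rewrite -scalerBr.
by apply: submoduleZ => //; exact: quo_repr_pi.
Qed.
Lemma quo_lieE x y : quo_lie (quo_pi x) (quo_pi y) = quo_pi (lie x y).
Proof.
have [sI Il] := ideal_setP I; apply/quo_piP.
set x' := quo_repr _; set y' := quo_repr _.
have -> : lie x' y' - lie x y = lie x' (y' - y) - lie y (x' - x).
  rewrite !lieDr !liexN opprD opprK [lie y x]lieC [lie y x']lieC opprK.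
  by rewrite addrA subrK.
apply: submoduleD => //; first exact/Il/quo_repr_pi.
by apply: submoduleN => //; exact/Il/quo_repr_pi.
Qed.

Let quoE := (quo_oppE, quo_addE, quo_scaleE, quo_lieE).

Fact quo_addA : associative quo_add.
Proof.
by elim/quo_ind=> x; elim/quo_ind=> y; elim/quo_ind=> z; rewrite !quoE addrA.
Qed.
Fact quo_addC : commutative quo_add.
Proof. by elim/quo_ind=> x; elim/quo_ind=> y; rewrite !quoE addrC. Qed.
Fact quo_add0 : left_id (quo_pi 0) quo_add.
Proof. by elim/quo_ind=> x; rewrite !quoE add0r. Qed.
Fact quo_addN : left_inverse (quo_pi 0) quo_opp quo_add.
Proof. by elim/quo_ind=> x; rewrite !quoE addNr. Qed.

HB.instance Definition _ := GRing.isZmodule.Build lie_quotient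
  quo_addA quo_addC quo_add0 quo_addN.

Fact quo_scaleA a b q : quo_scale a (quo_scale b q) = quo_scale (a * b) q.
Proof. by elim/quo_ind: q => x; rewrite !quoE scalerA. Qed.
Fact quo_scale1 : left_id 1 quo_scale.
Proof. by elim/quo_ind=> x; rewrite !quoE scale1r. Qed.
Fact quo_scaleDr : right_distributive quo_scale +%R.
Proof.
move=> a; elim/quo_ind=> x; elim/quo_ind=> y; rewrite /GRing.add /=.
by rewrite !quoE scalerDr.
Qed.
Fact quo_scaleDl q : {morph quo_scale^~ q : a b / a + b}.
Proof.
elim/quo_ind: q => x a b; rewrite [RHS]/GRing.add /=.
by rewrite !quoE scalerDl.
Qed.

HB.instance Definition _ := GRing.Zmodule_isLmodule.Build C lie_quotient
  quo_scaleA quo_scale1 quo_scaleDr quo_scaleDl.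

Let piD x y : quo_pi x + quo_pi y = quo_pi (x + y).
Proof. exact: quo_addE. Qed.
Let piZ (a : C) x : a *: quo_pi x = quo_pi (a *: x).
Proof. exact: quo_scaleE. Qed.

Fact quo_lie_linearl (a : C) p q r :
  quo_lie (a *: p + q) r = a *: quo_lie p r + quo_lie q r.
Proof.
elim/quo_ind: p => x; elim/quo_ind: q => y; elim/quo_ind: r => z.
by rewrite piZ piD !quo_lieE piZ piD lie_linearl.
Qed.
Fact quo_lie_linearr (a : C) p q r :
  quo_lie r (a *: p + q) = a *: quo_lie r p + quo_lie r q.
Proof.
elim/quo_ind: p => x; elim/quo_ind: q => y; elim/quo_ind: r => z.
by rewrite piZ piD !quo_lieE piZ piD lie_linearr.
Qed.
Fact quo_liexx q : quo_lie q q = 0.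
Proof. by elim/quo_ind: q => x; rewrite quoE liexx. Qed.
Fact quo_lie_jacobi p q r :
  quo_lie p (quo_lie q r) + (quo_lie q (quo_lie r p) + quo_lie r (quo_lie p q))
  = 0.
Proof.
elim/quo_ind: p => x; elim/quo_ind: q => y; elim/quo_ind: r => z.
by rewrite !quo_lieE !piD lie_jacobi.
Qed.

HB.instance Definition _ := isLieAlgebra.Build C lie_quotient
  quo_lie_linearl quo_lie_linearr quo_liexx quo_lie_jacobi.

Fact quo_pi_linear : linear quo_pi.
Proof. by move=> a x y; rewrite piZ piD. Qed.
Fact quo_pi_lie : {morph quo_pi : x y / lie x y >-> lie x y}.
Proof. by move=> x y; symmetry; exact: quo_lieE. Qed.

HB.instance Definition _ :=
  GRing.isLinear.Build C L lie_quotient *:%R quo_pi quo_pi_linear.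
HB.instance Definition _ :=
  isLieMorphism.Build C L lie_quotient quo_pi quo_pi_lie.

Section Lift.
Variables (M : lieAlgType C) (f : {lie L -> M}).
Hypothesis f0 : forall x, I x -> f x = 0.

Definition quo_lift of (forall x, I x -> f x = 0) :=
  fun q : lie_quotient => f (quo_repr q).

Local Notation g := (quo_lift f0).

Lemma quo_liftE x : g (quo_pi x) = f x.
Proof.
by apply/eqP; rewrite -subr_eq0 -raddfB; apply/eqP/f0/quo_repr_pi.
Qed.

Fact quo_lift_linear : linear g.
Proof.
move=> a; elim/quo_ind=> x; elim/quo_ind=> y.
by rewrite -linearP !quo_liftE linearP.
Qed.
Fact quo_lift_lie : {morph g : p q / lie p q >-> lie p q}.
Proof.
elim/quo_ind=> x; elim/quo_ind=> y.
by rewrite -lie_morph !quo_liftE lie_morph.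
Qed.

HB.instance Definition _ :=
  GRing.isLinear.Build C lie_quotient M *:%R g quo_lift_linear.
HB.instance Definition _ :=
  isLieMorphism.Build C lie_quotient M g quo_lift_lie.

End Lift.
End Quotient.

Lemma ideal_gen_kill (C : comPzRingType) (L M : lieAlgType C) (S : set L)
    (f : {lie L -> M}) :
  (forall x, S x -> f x = 0) -> forall x, ideal_gen S x -> f x = 0.
Proof.
move=> Sf x Ix; apply: (Ix [set y | f y = 0]) => //; split; last first.
  by move=> u v /= fv; rewrite lie_morph fv liex0.
split=> [|a u v /= fu fv]; first by rewrite /= raddf0.
by rewrite linearP /= fu fv scaler0 addr0.
Qed.

Definition presented (C : comPzRingType) (Y : Type) (S : set (freeLie C Y)) :=
  lie_quotient (ideal_gen S).
HB.instance Definition _ C Y S := LieAlgebra.on (@presented C Y S).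

Notation supp B := (finset.cover B).

Record set_arrangement (X : finType) := SetArrangement {
  arr_sets :> {set {set X}};
  arr_size : (1 < #|X|)%N;
  arr_card : forall A, A \in arr_sets -> (1 < #|A|)%N;
  arr_meet : forall A B, A \in arr_sets -> B \in arr_sets -> A != B ->
    (#|A :&: B| <= 1)%N;
  arr_cover : supp arr_sets = [set: X]%SET
}.

Record closed_subarrangement (X : finType) (A : set_arrangement X) :=
  ClosedSubarrangement {
    sub_sets :> {set {set X}};
    sub_subset : sub_sets \subset A;
    sub_closed : forall S, S \in A -> S \notin sub_sets ->
      (#|S :&: supp sub_sets| <= 1)%N
  }.

Definition elt (X : finType) (S : {set X}) := {x : X | x \in S}.

Definition elt_incl (X : finType) (S T : {set X}) (ST : S \subset T)
    (x : elt S) : elt T :=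
  exist _ (val x) (fintype.subsetP ST _ (valP x)).

(* The relators [R_A] are elements of the free Lie algebra on [A] itself; the
   value of [rel] outside the arrangement is irrelevant. *)
Record relators (C : comPzRingType) (X : finType) (A : set_arrangement X) :=
  Relators {
    relator_set :> forall S : {set X}, set (freeLie C (elt S));
    relator_derived : forall S, S \in arr_sets A ->
      @relator_set S `<=` derived (freeLie C (elt S))
  }.
Arguments relator_set {C X A} r S : rename.

Section ArrangementAlgebra.
Variables (C : comPzRingType) (X : finType) (A : set_arrangement X).
Variable R : relators C A.

Definition arr_relations : set (freeLie C X) :=
  [set w | exists x y : X,
     (forall S, S \in arr_sets A -> ~~ ([set x; y]%SET \subset S)) /\
     w = lie (free_gen C x) (free_gen C y)] `|`
  [set w | exists S : {set X}, S \in arr_sets A /\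
     exists2 r, R S r & w = free_map C (fun z : elt S => val z) r].

Definition arr_alg := presented arr_relations.
HB.instance Definition _ := LieAlgebra.on arr_alg.

Definition arr_pi : {lie freeLie C X -> arr_alg} :=
  quo_pi (ideal_gen arr_relations).

Definition arr_gen (x : X) : arr_alg := arr_pi (free_gen C x).

Section Localization.
Variable B : closed_subarrangement A.

Lemma sub_supp (S : {set X}) : S \in sub_sets B -> S \subset supp B.
Proof.
by move=> SB; apply/fintype.subsetP=> z zS; apply/finset.bigcupP; exists S.
Qed.

Definition loc_relations : set (freeLie C (elt (supp B))) :=
  [set w | exists (S : {set X}) (SB : S \in sub_sets B),
     exists2 r, R S r & w = free_map C (elt_incl (sub_supp SB)) r] `|`
  [set w | exists x y : elt (supp B),
     (forall S, S \in sub_sets B -> ~~ ([set val x; val y]%SET \subset S)) /\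
     w = lie (free_gen C x) (free_gen C y)].

Definition loc_alg := presented loc_relations.
HB.instance Definition _ := LieAlgebra.on loc_alg.

Definition loc_pi : {lie freeLie C (elt (supp B)) -> loc_alg} :=
  quo_pi (ideal_gen loc_relations).

Definition loc_gen (x : elt (supp B)) : loc_alg := loc_pi (free_gen C x).

Definition loc_s_free : {lie freeLie C (elt (supp B)) -> arr_alg} :=
  free_lift (fun x => arr_gen (val x)).

Lemma loc_s_subproof w : loc_relations w -> loc_s_free w = 0.
Proof.
case=> [[S [SB [r Rr ->]]]|[x [y [nxy ->]]]].
  have SA : S \in arr_sets A by exact: (fintype.subsetP (sub_subset B)) SB.
  rewrite [LHS]free_lift_map.
  rewrite -[LHS](free_lift_comp arr_pi (fun z : elt S => free_gen C (val z))).
  apply/quo_piP; rewrite subr0.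
  by apply: ideal_span_sub; right; exists S; split=> //; exists r.
rewrite lie_morph /= !free_liftE.
have [->|neq] := eqVneq (val x) (val y); first by rewrite liexx.
rewrite -lie_morph; apply/quo_piP; rewrite subr0.
apply: ideal_span_sub; left; exists (val x), (val y); split=> // S SA.
have [/nxy//|SnB] := boolP (S \in sub_sets B).
apply: contraL (sub_closed SA SnB) => xyS; rewrite -ltnNge.
apply: leq_trans (subset_leq_card (_ : [set val x; val y]%SET \subset _)).
  by rewrite cards2 neq.
rewrite finset.subsetI xyS; apply/fintype.subsetP => z.
by rewrite !inE => /orP[]/eqP->; apply: valP.
Qed.

(* The morphism s_B, sending each generator to itself. *)
Definition loc_s : {lie loc_alg -> arr_alg} :=
  quo_lift (ideal_gen_kill loc_s_subproof).

Lemma loc_s_gen (x : elt (supp B)) : loc_s (loc_gen x) = arr_gen (val x).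
Proof. by rewrite [LHS]quo_liftE [LHS]free_liftE. Qed.

Definition loc_proj_gen (x : X) : loc_alg :=
  if insub x is Some y then loc_gen y else 0.

Definition loc_proj_free : {lie freeLie C X -> loc_alg} :=
  free_lift loc_proj_gen.

Lemma loc_proj_subproof w : arr_relations w -> loc_proj_free w = 0.
Proof.
case=> [[x [y [nxy ->]]]|[S [SA [r Rr ->]]]].
  rewrite lie_morph /= !free_liftE /loc_proj_gen.
  case: insubP => [x' _ Ex|_]; last by rewrite lie0x.
  case: insubP => [y' _ Ey|_]; last by rewrite liex0.
  rewrite -lie_morph; apply/quo_piP; rewrite subr0.
  apply: ideal_span_sub; right; exists x', y'; split=> // S SB.
  by rewrite Ex Ey; apply: nxy; apply: (fintype.subsetP (sub_subset B)).
rewrite [LHS]free_lift_map.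
have [SB|SnB] := boolP (S \in sub_sets B).
  have/eq_free_lift-> : loc_proj_gen \o (fun z : elt S => val z) =1
      loc_pi \o (fun z => free_gen C (elt_incl (sub_supp SB) z)).
    move=> z; rewrite /= /loc_proj_gen.
    case: insubP => [y _ Ey|/negP[]]; last first.
      exact: (fintype.subsetP (sub_supp SB) _ (valP z)).
    by congr (loc_pi (free_gen C _)); apply: val_inj; rewrite Ey.
  rewrite -free_lift_comp; apply/quo_piP; rewrite subr0.
  by apply: ideal_span_sub; left; exists S, SB, r.
have := sub_closed SA SnB; rewrite leq_eqVlt ltnS leqn0.
have Dr := relator_derived SA Rr.
case/orP=> [/cards1P[z Ez]|/eqP/cards0_eq E0].
  apply: (free_lift_line_derived (v := loc_proj_gen z)) Dr => y /=.
  have [yB|yB] := boolP (val y \in supp B).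
    exists 1; rewrite scale1r; congr loc_proj_gen; apply/set1P.
    by rewrite -Ez inE yB andbT; apply: valP.
  by exists 0; rewrite scale0r /loc_proj_gen insubN.
apply: (free_lift_line_derived (v := 0)) Dr => y /=.
exists 0; rewrite scale0r /loc_proj_gen insubN //.
apply/negP=> yB; have : val y \in S :&: supp B.
  by rewrite inE yB andbT; apply: valP.
by rewrite E0 inE.
Qed.

(* The morphism pi_B, fixing the generators in the support of B and killing
   the others. *)
Definition loc_proj : {lie arr_alg -> loc_alg} :=
  quo_lift (ideal_gen_kill loc_proj_subproof).

Lemma loc_proj_gen_in (x : elt (supp B)) :
  loc_proj (arr_gen (val x)) = loc_gen x.
Proof. by rewrite [LHS]quo_liftE [LHS]free_liftE /loc_proj_gen valK. Qed.

Lemma loc_proj_gen_out (x : X) : x \notin supp B -> loc_proj (arr_gen x) = 0.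
Proof.
by move=> xB; rewrite [LHS]quo_liftE [LHS]free_liftE /loc_proj_gen insubN.
Qed.

End Localization.
End ArrangementAlgebra.

Section Decomposition.
Variables (C : comPzRingType) (X : finType) (A : set_arrangement X).
Variables (R : relators C A) (I : finType) (B : I -> closed_subarrangement A).

(* im(s_B') as a Lie subalgebra of the Lie algebra of the arrangement. *)
Definition im_s' (D : closed_subarrangement A) : lieSubalgebra (arr_alg R) :=
  derived_image (loc_s R D).

Definition s'_map
    (u : lie_dsum (fun i => derived_alg (loc_alg R (B i)) : lieAlgType C)) :
    derived_alg (arr_alg R) :=
  \sum_i derived_map (loc_s R (B i)) (u i).

Definition pi'_map (v : derived_alg (arr_alg R)) :
    lie_dsum (fun i => derived_alg (loc_alg R (B i)) : lieAlgType C) :=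
  fun i => derived_map (loc_proj R (B i)) v.

End Decomposition.

(* Main.v *)
(** Since distinct blocks [S] meet in at most one point, two distinct
    generators in [supp D] and in [supp E], with [D] and [E] disjoint and
    closed, already commute in the localization at [D].  Hence [pi_E \o s_D]
    kills the derived algebra, while [pi_D \o s_D = id], so [pi' \o s' = id]
    unconditionally: surjectivity of [s'] and injectivity of [pi'] both say
    that the two maps are mutually inverse.  If the images of the [s'_i] are
    ideals, their sum is an ideal containing all brackets of generators, hence
    the whole derived algebra.  Conversely, if [x] is outside [supp (B i)] and
    [y] is in the image of [s'_i], then every component of [pi' [x, y]]
    vanishes: the [i]-th because [pi_i x = 0], the others because
    [pi_j y = 0]. *)

Require Import Defs.
From HB Require Import structures.
From mathcomp Require Import all_boot all_order all_algebra.
From mathcomp Require Import boolp classical_sets.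

Set Implicit Arguments.
Unset Strict Implicit.
Unset Printing Implicit Defensive.

Import GRing.Theory.

Local Open Scope ring_scope.

(** * Generating families of a Lie algebra *)

Section Generation.
Local Open Scope classical_set_scope.
Variables (C : comPzRingType) (L : lieAlgType C).

(** Phrased as an induction principle: a property that cuts out a subalgebra need only be checked on
    [G]. *)
Definition lie_generated (Y : Type) (G : Y -> L) : Prop :=
  forall U : set L, is_lie_subalgebra U -> (forall y, U (G y)) ->
  forall x, U x.

Lemma lie_jacobi_der (x y z : L) :
  lie (lie x y) z = lie x (lie y z) - lie y (lie x z).
Proof.
have /eqP := lie_jacobi x y z; rewrite addrA addr_eq0 => /eqP.
by rewrite [lie (lie x y) z]lieC => <-; rewrite [lie z x]lieC liexN.
Qed.

(** By Jacobi, [[[x,y],t] = [x,[y,t]] - [y,[x,t]]]; the inner brackets lie in [J], and the second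
    hypothesis keeps the outer ones there. That hypothesis is immediate when [J] is an ideal and
    when [T = J]. *)
Lemma transporter_subalgebra (T J : set L) :
  is_submodule J ->
  (forall z, (forall t, T t -> J (lie z t)) -> forall t, J t -> J (lie z t)) ->
  is_lie_subalgebra [set z | forall t, T t -> J (lie z t)].
Proof.
move=> sJ stJ; split; first split.
- by move=> t _; rewrite lie0x; case: sJ.
- move=> a x y Jx Jy t Tt; rewrite lie_linearl.
  by apply: sJ.2; [apply: Jx|apply: Jy].
- move=> x y Jx Jy t Tt; rewrite lie_jacobi_der.
  apply: submoduleD => //; first by apply: stJ => //; apply: Jy.
  by apply: submoduleN => //; apply: stJ => //; apply: Jx.
Qed.

(** Induction over the generators runs twice: on the left argument with a generator on the right,
    then, after antisymmetry, on the other argument. *)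
Lemma derived_sub_ideal (Y : Type) (G : Y -> L) (J : set L) :
  lie_generated G -> is_lie_ideal J -> (forall x y, J (lie (G x) (G y))) ->
  derived L `<=` J.
Proof.
move=> genG [sJ iJ] JG; pose tr T := [set z | forall t, T t -> J (lie z t)].
have trP T : is_lie_subalgebra (tr T).
  by apply: transporter_subalgebra => // z _ t; apply: iJ.
have JxG x y : J (lie x (G y)).
  by apply: (genG _ (trP (range G))) => [z _ [y' _ <-]|]; [apply: JG|exists y].
have JL x y : J (lie x y).
  apply: (genG _ (trP setT)) => // z t _.
  by rewrite lieC; apply: submoduleN.
by move=> x Lx; apply: Lx => // _ [y [z ->]].
Qed.

Lemma lie_morph_kill_derived (Y : Type) (G : Y -> L) (M : lieAlgType C)
    (f : {lie L -> M}) :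
  lie_generated G -> (forall x y, f (lie (G x) (G y)) = 0) ->
  forall x, derived L x -> f x = 0.
Proof.
move=> genG fG; apply: (derived_sub_ideal (J := [set x | f x = 0]) genG) => //.
split; last by move=> x y /= fy; rewrite lie_morph fy liex0.
split=> [|a x y /= fx fy]; rewrite /= ?raddf0 //.
by rewrite linearP /= fx fy scaler0 addr0.
Qed.

Lemma lie_morph_id (Y : Type) (G : Y -> L) (f : {lie L -> L}) :
  lie_generated G -> (forall y, f (G y) = G y) -> f =1 id.
Proof.
move=> genG fG x; apply: (genG [set x | f x = x]) => //; split; first split.
- by rewrite /= raddf0.
- by move=> a u v /= fu fv; rewrite linearP /= fu fv.
- by move=> u v /= fu fv; rewrite lie_morph fu fv.
Qed.

Lemma submodule_sum_ideal (I : finType) (U : I -> lieSubalgebra L) :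
  (forall i, is_lie_ideal (U i)) -> is_lie_ideal (submodule_sum U).
Proof.
move=> iU; split; first split.
- by exists (fun=> 0); [move=> i; case: (iU i) => -[]|rewrite big1].
- move=> a _ _ [u Uu ->] [v Uv ->]; exists (fun i => a *: u i + v i).
    by move=> i; apply: (iU i).1.2.
  by rewrite big_split scaler_sumr.
- move=> x _ [u Uu ->]; exists (fun i => lie x (u i)).
    by move=> i; apply: (iU i).2.
  by apply: (big_morph (lie x)) => [y z|]; [apply: lieDr|apply: liex0].
Qed.

Lemma submodule_sum_sub (I : finType) (U : I -> lieSubalgebra L) i :
  U i `<=` submodule_sum U.
Proof.
move=> x Ux; exists (fun j => if j == i then x else 0).
  move=> j; case: eqP => [->//|_].
  by case: (subalgebra_setP (U j)) => -[].
by rewrite -big_mkcond big_pred1_eq.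
Qed.

Lemma derivedP (x y : L) : derived L (lie x y).
Proof. by apply: submodule_span_sub; exists x, y. Qed.

End Generation.

(** Every element is the class of a formal term, so structural induction on terms applies. *)
Lemma presented_generated (C : comPzRingType) (Y : Type)
    (S : set (freeLie C Y)) :
  lie_generated (L := presented S)
    (fun y => quo_pi (ideal_gen S) (free_gen C y)).
Proof.
move=> U [sU lU] UG; elim/quo_ind; elim/free_ind.
elim=> [y||t IH|s IHs t IHt|a t IH|s IHs t IHt].
- exact: UG.
- rewrite -[free_class _]/(0 : freeLie C Y) raddf0; by case: sU.
- rewrite -free_oppE -[free_opp _]/(- free_class t) raddfN.
  exact: submoduleN.
- rewrite -free_addE -[free_add _ _]/(free_class s + free_class t) raddfD.
  exact: submoduleD.
- rewrite -free_scaleE -[free_scale _ _]/(a *: free_class t) linearZ.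
  exact: submoduleZ.
- rewrite -free_lieE -[free_lie _ _]/(lie (free_class s) (free_class t)).
  by rewrite lie_morph; apply: lU.
Qed.

(** * The maps [s_D] and [pi_E] for closed sub-arrangements *)

Section Arrangement.
Variables (C : comPzRingType) (X : finType) (A : set_arrangement X).
Variable R : relators C A.
Implicit Types D E : closed_subarrangement A.

Lemma arr_generated : lie_generated (arr_gen R).
Proof. exact: presented_generated. Qed.

Lemma loc_generated D : lie_generated (loc_gen R (B := D)).
Proof. exact: presented_generated. Qed.

Lemma loc_sK D : cancel (loc_s R D) (loc_proj R D).
Proof.
move=> x; apply: (lie_morph_id (f := loc_proj R D \o loc_s R D)
  (@loc_generated D)) => y.
rewrite -[LHS]/(loc_proj R D (loc_s R D _)) loc_s_gen.
exact: loc_proj_gen_in.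
Qed.

Lemma arr_gen_comm (x y : X) :
  (forall S, S \in arr_sets A -> ~~ ([set x; y]%SET \subset S)) ->
  lie (arr_gen R x) (arr_gen R y) = 0.
Proof.
move=> nxy; rewrite -lie_morph; apply/quo_piP; rewrite subr0.
by apply: ideal_span_sub; left; exists x, y.
Qed.

Lemma loc_gen_comm D (x y : elt (supp D)) :
  (forall S, S \in sub_sets D -> ~~ ([set val x; val y]%SET \subset S)) ->
  lie (loc_gen R x) (loc_gen R y) = 0.
Proof.
move=> nxy; rewrite -lie_morph; apply/quo_piP; rewrite subr0.
by apply: ideal_span_sub; right; exists x, y.
Qed.

(** It suffices to treat brackets of two generators: [pi_E] kills a generator outside [supp E], and
    two distinct ones inside commute. *)
Lemma loc_proj_s_derived D E (u : loc_alg R D) :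
  [disjoint D & E] -> derived (loc_alg R D) u -> loc_proj R E (loc_s R D u) = 0.
Proof.
move=> dDE.
apply: (lie_morph_kill_derived (f := loc_proj R E \o loc_s R D)
  (@loc_generated D)) => x y.
rewrite -[LHS]/(loc_proj R E (loc_s R D _)) !lie_morph !loc_s_gen.
have [xE|/(loc_proj_gen_out R)->] := boolP (val x \in supp E); last first.
  by rewrite lie0x.
have [yE|/(loc_proj_gen_out R)->] := boolP (val y \in supp E); last first.
  by rewrite liex0.
have [->|neq] := eqVneq (val x) (val y); first by rewrite liexx.
(* The bracket is pulled back to the localization at [D], where it is already a relator. *)
rewrite -lie_morph -!loc_s_gen -lie_morph loc_gen_comm ?raddf0 // => S SD.
have SE : S \notin sub_sets E by rewrite (disjointFr dDE).
have SA : S \in arr_sets A by exact: (fintype.subsetP (sub_subset D)) SD.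
(* A block of [D] containing both points would meet [supp E] twice, although [E] is closed. *)
apply: contraL (sub_closed SA SE) => xyS; rewrite -ltnNge.
apply: leq_trans (subset_leq_card (_ : [set val x; val y]%SET \subset _)).
  by rewrite cards2 neq.
by rewrite finset.subsetI xyS; apply/fintype.subsetP => z /set2P[]->.
Qed.

Lemma im_s'P D (x : arr_alg R) :
  im_s' R D x <-> exists2 u, derived (loc_alg R D) u & x = loc_s R D u.
Proof.
split=> [[u _ <-]|[u Du ->]].
  by exists (val u) => //; apply: subalgebra_typeP.
by exists (subalgebra_elt Du).
Qed.

Lemma im_s'_derived D : (im_s' R D `<=` derived (arr_alg R))%classic.
Proof. by move=> _ [u _ <-]; apply: subalgebra_typeP. Qed.

Lemma loc_proj_im_s' D E (x : arr_alg R) :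
  [disjoint D & E] -> im_s' R D x -> loc_proj R E x = 0.
Proof. by move=> dDE /im_s'P[u Du ->]; apply: loc_proj_s_derived. Qed.

Lemma loc_proj_im_s'_inj D (x : arr_alg R) :
  im_s' R D x -> loc_proj R D x = 0 -> x = 0.
Proof. by move=> /im_s'P[u _ ->]; rewrite loc_sK => ->; rewrite raddf0. Qed.

(** The elements that bracket the image into itself form a subalgebra. It contains the generators
    outside [supp D] by hypothesis and those inside because [s_D] is a morphism. *)
Lemma im_s'_ideal D :
  (forall x : X, x \notin supp D ->
     forall y, im_s' R D y -> lie (arr_gen R x) y = 0) ->
  is_lie_ideal (im_s' R D).
Proof.
move=> D1; have [sD _] := subalgebra_setP (im_s' R D); split=> // x.
apply: (arr_generated
  (transporter_subalgebra (T := im_s' R D) sD (fun z h => h))) => {}x y Dy.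
have [xD|/D1->//] := boolP (x \in supp D); last by case: sD.
have [u Du ->] := (im_s'P D y).1 Dy; apply/im_s'P.
exists (lie (loc_gen R (exist _ x xD : elt (supp D))) u); first exact: derivedP.
by rewrite lie_morph loc_s_gen.
Qed.

(** * Families of closed sub-arrangements that partition the arrangement *)

Section Decomposition.
Variables (I : finType) (B : I -> closed_subarrangement A).
Hypothesis Bcover : (\bigcup_i sub_sets (B i))%SET = arr_sets A.

(** The sum is an ideal, and a bracket of two generators is zero unless some block contains both;
    that block belongs to some [B i], so the bracket comes from the localization there. *)
Lemma submodule_sum_derived :
  (forall i, is_lie_ideal (im_s' R (B i))) ->
  derived (arr_alg R) = submodule_sum (fun i => im_s' R (B i))
    :> set (arr_alg R).
Proof.
move=> iB; have iS := submodule_sum_ideal iB; apply/seteqP; split; last first.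
  have [sL _] := derived_setP (arr_alg R).
  move=> _ [u Bu ->]; apply: (big_ind (derived (arr_alg R))).
  - by case: sL.
  - by move=> x y; apply: submoduleD.
  - by move=> i _; apply: im_s'_derived (Bu i).
apply: (derived_sub_ideal arr_generated iS) => x y.
have [[S [SA xyS]]|nxy] :=
    pselect (exists S, S \in arr_sets A /\ [set x; y]%SET \subset S); last first.
  rewrite arr_gen_comm => [|S SA]; first by case: iS => -[].
  by apply/negP=> xyS; apply: nxy; exists S.
move: SA; rewrite -Bcover => /finset.bigcupP[i _ SB].
apply: (@submodule_sum_sub _ _ _ _ i); apply/im_s'P.
have supB z : z \in [set x; y]%SET -> z \in supp (B i).
  by move=> /(fintype.subsetP xyS)/(fintype.subsetP (sub_supp SB)).
have xB := supB x (set21 x y); have yB := supB y (set22 x y).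
exists (lie (loc_gen R (exist _ x xB : elt (supp (B i))))
            (loc_gen R (exist _ y yB : elt (supp (B i))))).
  exact: derivedP.
by rewrite lie_morph !loc_s_gen.
Qed.

Hypothesis Bdisj : forall i j, i != j -> [disjoint B i & B j].

Lemma loc_proj_sum (u : I -> arr_alg R) j :
  (forall i, im_s' R (B i) (u i)) ->
  loc_proj R (B j) (\sum_i u i) = loc_proj R (B j) (u j).
Proof.
move=> Bu; rewrite raddf_sum (bigD1 j) //= big1 ?addr0 // => i ij.
exact: loc_proj_im_s' (Bdisj ij) (Bu i).
Qed.

Lemma val_s'_map u :
  val (@s'_map _ _ _ R _ B u) = \sum_i loc_s R (B i) (val (u i)).
Proof. exact: raddf_sum. Qed.

(** In component [j] the projection kills all summands but the [j]-th, which it recovers by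
    [loc_sK]. *)
Lemma s'_mapK : cancel (@s'_map _ _ _ R _ B) (@pi'_map _ _ _ R _ B).
Proof.
move=> u; apply: functional_extensionality_dep => j; apply: val_inj.
rewrite -[LHS]/(loc_proj R (B j) (val (s'_map u))) val_s'_map.
rewrite loc_proj_sum => [|i]; first exact: loc_sK.
by exists (u i).
Qed.

(** The bracket lies in both ideals: [pi_i] kills it as an element of the [j]-th image, yet is
    injective on the [i]-th. *)
Lemma lie_im_s' i j (x y : arr_alg R) :
  (forall i, is_lie_ideal (im_s' R (B i))) -> i != j ->
  im_s' R (B i) x -> im_s' R (B j) y -> lie x y = 0.
Proof.
move=> iB ij Bx By; have Bxy : im_s' R (B j) (lie x y) by apply: (iB j).2.
apply: (@loc_proj_im_s'_inj (B i)); last first.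
  by apply: (loc_proj_im_s' _ Bxy); rewrite disjoint_sym Bdisj.
rewrite lieC; apply: submoduleN; first exact: (iB i).1.
exact: (iB i).2.
Qed.

Lemma im_s'_internal_dsum :
  (forall i, is_lie_ideal (im_s' R (B i))) ->
  lie_internal_dsum (derived (arr_alg R)) (fun i => im_s' R (B i)).
Proof.
move=> iB.
have Ui (u : forall i, subalgebra_type (im_s' R (B i))) i :
    im_s' R (B i) (val (u i)) by apply: subalgebra_typeP.
split.
- rewrite submodule_sum_derived //; apply/seteqP.
  split=> [_ [u _ <-]|_ [u Bu ->]].
    by exists (fun i => val (u i)).
  by exists (fun i => subalgebra_elt (Bu i)).
(* Projecting the two equal sums by [pi_j] isolates their [j]-th terms, and [pi_j] is injective on
   the [j]-th image. *)
- move=> u v uv; apply: functional_extensionality_dep => j; apply: val_inj.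
  apply/eqP; rewrite -subr_eq0; apply/eqP/(@loc_proj_im_s'_inj (B j)).
    apply: submoduleD; [exact: (iB j).1|exact: Ui|].
    by apply: submoduleN; [exact: (iB j).1|exact: Ui].
  apply/eqP; rewrite raddfB subr_eq0; apply/eqP.
  have := congr1 (loc_proj R (B j)) uv.
  by rewrite /dsum_addition (loc_proj_sum _ (Ui u)) (loc_proj_sum _ (Ui v)).
(* Expanding the bracket of the two sums leaves only diagonal terms, by [lie_im_s']. *)
- move=> u v; rewrite /dsum_addition.
  rewrite (big_morph (lie ^~ _) (id1 := 0) (op1 := +%R)); last 2 first.
  + by move=> x y; apply: lieDl.
  + exact: lie0x.
  apply: eq_bigr => i _.
  rewrite (big_morph (lie _) (id1 := 0) (op1 := +%R)); last 2 first.
  + by move=> x y; apply: lieDr.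
  + exact: liex0.
  rewrite (bigD1 i) //= big1 ?addr0 // => j ji.
  by apply: lie_im_s' (Ui u i) (Ui v j) => //; rewrite eq_sym.
Qed.

Local Notation pi' := (@pi'_map _ _ _ R _ B).

Fact pi'_map_linear : linear pi'.
Proof.
move=> a u v; apply: functional_extensionality_dep => i.
exact: linearP.
Qed.

Fact pi'_map_lie : {morph pi' : u v / lie u v >-> lie u v}.
Proof.
move=> u v; apply: functional_extensionality_dep => i.
exact: lie_morph.
Qed.

HB.instance Definition _ := GRing.isLinear.Build C (derived_alg (arr_alg R))
  (lie_dsum (fun i => derived_alg (loc_alg R (B i)) : lieAlgType C))
  *:%R pi' pi'_map_linear.
HB.instance Definition _ := isLieMorphism.Build C (derived_alg (arr_alg R))
  (lie_dsum (fun i => derived_alg (loc_alg R (B i)) : lieAlgType C))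
  pi' pi'_map_lie.

Lemma pi'_map_iso : injective pi' ->
  lie_isomorphic (derived_alg (arr_alg R))
    (lie_dsum (fun i => derived_alg (loc_alg R (B i)) : lieAlgType C)).
Proof.
move=> injpi; exists pi', (@s'_map _ _ _ R _ B); last exact: s'_mapK.
exact: inj_can_sym s'_mapK injpi.
Qed.

Lemma submodule_sum_s'_surj :
  derived (arr_alg R) = submodule_sum (fun i => im_s' R (B i))
    :> set (arr_alg R) ->
  forall v : derived_alg (arr_alg R), exists u, s'_map (B := B) u = v.
Proof.
move=> E v; have := subalgebra_typeP v; rewrite E => -[w Bw Ew].
have wP i : exists u, val (derived_map (loc_s R (B i)) u) = w i.
  by have [u _ <-] := Bw i; exists u.
(* [cid] chooses a preimage of each component. *)
exists (fun i => projT1 (cid (wP i))); apply: val_inj; rewrite Ew val_s'_map.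
by apply: eq_bigr => i _; rewrite -[RHS](projT2 (cid (wP i))).
Qed.

Lemma pi'_inj_comm (i : I) (x : X) (y : arr_alg R) :
  injective pi' -> x \notin supp (B i) -> im_s' R (B i) y ->
  lie (arr_gen R x) y = 0.
Proof.
move=> injpi xB By.
(* The bracket is packaged as an element of the derived algebra, the domain of [pi']. *)
suff: subalgebra_elt (U := derived (arr_alg R)) (derivedP (arr_gen R x) y) = 0.
  by move=> /(congr1 val).
apply: injpi; rewrite raddf0; apply: functional_extensionality_dep => j.
apply: val_inj; rewrite -[LHS]/(loc_proj R (B j) (lie _ _)) lie_morph.
have [->|ij] := eqVneq j i; first by rewrite loc_proj_gen_out // lie0x.
by rewrite (loc_proj_im_s' _ By) ?liex0 // Bdisj // eq_sym.
Qed.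

End Decomposition.
End Arrangement.

Theorem theorem3p6 (C : comPzRingType) (X : finType) (A : set_arrangement X)
    (R : relators C A) (k : nat) (B : 'I_k -> closed_subarrangement A)
    (Bdisj : forall i j : 'I_k, i != j -> [disjoint B i & B j])
    (Bcover : (\bigcup_(i < k) sub_sets (B i))%SET = arr_sets A) :
  [<-> (* 1 *) forall (i : 'I_k) (x : X), x \notin supp (B i) ->
         forall y : arr_alg R, im_s' R (B i) y -> lie (arr_gen R x) y = 0%R;
       (* 2 *) forall i : 'I_k, is_lie_ideal (im_s' R (B i));
       (* 3 *) derived (arr_alg R) = submodule_sum (fun i => im_s' R (B i))
                 :> set (arr_alg R);
       (* 4 *) forall v : derived_alg (arr_alg R),
                 exists u, s'_map (B := B) u = v;
       (* 5 *) injective (pi'_map (R := R) B)] /\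
  ((forall (i : 'I_k) (x : X), x \notin supp (B i) ->
      forall y : arr_alg R, im_s' R (B i) y -> lie (arr_gen R x) y = 0%R) ->
   lie_internal_dsum (derived (arr_alg R)) (fun i => im_s' R (B i)) /\
   lie_isomorphic (derived_alg (arr_alg R))
     (lie_dsum (fun i => derived_alg (loc_alg R (B i)) : lieAlgType C))).
Proof.
have P12 : (forall (i : 'I_k) (x : X), x \notin supp (B i) ->
      forall y, im_s' R (B i) y -> lie (arr_gen R x) y = 0%R) ->
    forall i, is_lie_ideal (im_s' R (B i)).
  by move=> P1 i; apply: im_s'_ideal (P1 i).
have P23 := submodule_sum_derived (R := R) Bcover.
have P45 : (forall v, exists u, s'_map (R := R) (B := B) u = v) ->
    injective (pi'_map (R := R) B).
  (* Both arguments are written as values of [s'], from which [pi'] returns the preimages. *)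
  move=> s'surj v w; have [u <-] := s'surj v; have [u' <-] := s'surj w.
  by rewrite !(s'_mapK Bdisj) => ->.
(* The equivalence is the cycle 1, 2, 3, 4, 5, 1. *)
split; first tfae.
- exact: P12.
- exact: P23.
- exact: submodule_sum_s'_surj.
- exact: P45.
- by move=> injpi i x xB y; apply: pi'_inj_comm.
move=> P1; have P2 := P12 P1; split; first exact: im_s'_internal_dsum.
apply: pi'_map_iso => //; apply: P45.
by apply: submodule_sum_s'_surj; apply: P23.
Qed.
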